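(* Let $L$ be a bounded lattice and $\to$ a preconditional on $L$. Let $P=\{(x,x\to y)\mid x,y\in L\}$ and define $\vartriangleleft$ on $P$ by $(a,b)\vartriangleleft(c,d)$ iff $c\not\le b$. Then there is a complete embedding of $(L,\to)$ into $(\mathfrak{L}(P,\vartriangleleft),\twoheadrightarrow_\vartriangleleft)$, which is an isomorphism if $L$ is complete.
   Context: A preconditional on a bounded lattice $L$ is a binary operation $\to$ such that for all $a,b,c$: (1) $1\to a\le a$; (2) $a\wedge b\le a\to b$; (3) $a\to b\le a\to(a\wedge b)$; (4) if $b\le a$ then $a\to(b\to c)\le b\to c$; (5) if $b\le c$ then $a\to b\le a\to c$. For a nonempty set $X$ with binary relation $\vartriangleleft$ (write $y\vartriangleright x$ for $x\vartriangleleft y$): $c_\vartriangleleft(A)=\{x\mid\forall x'\vartriangleleft x\ \exists x''\vartriangleright x':x''\in A\}$; $\mathfrak{L}(X,\vartriangleleft)$ is the complete lattice of $c_\vartriangleleft$-fixpoints ordered by inclusion (meets are intersections, joins are $c_\vartriangleleft$ of unions); $A\twoheadrightarrow_\vartriangleleft B=\{x\mid\forall y\vartriangleleft x\,(y\in A\Rightarrow\exists z\vartriangleright y: z\in A\cap B)\}$. A complete embedding is an injective map preserving all existing meets and joins and commuting with the extra operation(s). *)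

(* Defs.v *)
From HB Require Import structures.
From mathcomp Require Import all_boot all_order.
From mathcomp Require Import boolp classical_sets.

Set Implicit Arguments.
Unset Strict Implicit.
Unset Printing Implicit Defensive.

Import Order.TTheory.
Local Open Scope order_scope.
Local Open Scope classical_set_scope.

Record preconditional (d : Order.disp_t) (L : tbLatticeType d)
    (imp : L -> L -> L) : Prop := Preconditional {
  pcond_top : forall a, imp \top a <= a;
  pcond_meet_le : forall a b, (a `&` b)%O <= imp a b;
  pcond_le_meet : forall a b, imp a b <= imp a (a `&` b)%O;
  pcond_weaken : forall a b c, b <= a -> imp a (imp b c) <= imp b c;
  pcond_mono : forall a b c, b <= c -> imp a b <= imp a c }.

Definition is_complete_lattice (d : Order.disp_t) (L : tbLatticeType d) : Prop :=
  forall S : set L, infimums S !=set0 /\ supremums S !=set0.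

(* [S] ranges over all subsets, including the empty one, so a complete
   embedding preserves the bounds in particular. *)
Record complete_embedding (d d' : Order.disp_t) (L : tbLatticeType d)
    (M : tbLatticeType d') (impL : L -> L -> L) (impM : M -> M -> M)
    (f : L -> M) : Prop := CompleteEmbedding {
  cemb_inj : injective f;
  cemb_meet : forall (S : set L) m, infimums S m -> infimums (f @` S) (f m);
  cemb_join : forall (S : set L) m, supremums S m -> supremums (f @` S) (f m);
  cemb_imp : {morph f : a b / impL a b >-> impM a b} }.

Record lattice_isomorphism (d d' : Order.disp_t) (L : tbLatticeType d)
    (M : tbLatticeType d') (impL : L -> L -> L) (impM : M -> M -> M)
    (f : L -> M) : Prop := LatticeIsomorphism {
  liso_bij : bijective f;
  liso_le : {mono f : a b / a <= b};
  liso_imp : {morph f : a b / impL a b >-> impM a b} }.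

(* [R y x] is to be read as y <| x. *)
Section RelationalFrame.
Variables (X : Type) (R : X -> X -> Prop).
Implicit Types (x y z : X) (A B C : set X).

Definition frame_closure A : set X :=
  [set x | forall x', R x' x -> exists x'', R x' x'' /\ A x''].

Definition frame_imp A B : set X :=
  [set x | forall y, R y x -> A y -> exists z, R y z /\ (A `&` B) z].

Definition frame_fixpoint : set (set X) := [set A | frame_closure A = A].

Lemma frame_closure_sub A : A `<=` frame_closure A.
Proof. by move=> x Ax x' x'x; exists x. Qed.

Lemma frame_closureS A B : A `<=` B -> frame_closure A `<=` frame_closure B.
Proof.
by move=> AB x cx x' /cx[x'' [x'x'' Ax'']]; exists x''; split=> //; apply: AB.
Qed.

Lemma frame_fixpointP A : frame_closure A `<=` A -> frame_fixpoint A.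
Proof.
by move=> cA; apply/seteqP; split=> //; apply: frame_closure_sub.
Qed.

Lemma frame_fixpoint_sub A : frame_fixpoint A -> frame_closure A `<=` A.
Proof. by move=> ->. Qed.

Lemma frame_closure_fixpoint A : frame_fixpoint (frame_closure A).
Proof.
by apply: frame_fixpointP => x cx x' /cx[y [x'y cy]]; apply: cy.
Qed.

Lemma frame_imp_fixpoint A B : frame_fixpoint (frame_imp A B).
Proof.
apply: frame_fixpointP => x cx y yx Ay.
by have [x'' [yx'']] := cx _ yx; apply.
Qed.

Lemma frame_bigcap_fixpoint (I : Type) (S : set I) (F : I -> set X) :
  (forall i, frame_fixpoint (F i)) -> frame_fixpoint (\bigcap_(i in S) F i).
Proof.
move=> FF; apply: frame_fixpointP => x cx i Si.
by apply: (frame_fixpoint_sub (FF i)); apply: frame_closureS cx => y; apply.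
Qed.

Record fix_lattice : Type := FixLattice {
  fix_set :> set X;
  fix_setP : fix_set \in frame_fixpoint }.

HB.instance Definition _ := [isSub of fix_lattice for fix_set].
HB.instance Definition _ := [Choice of fix_lattice by <:].
HB.instance Definition _ := [SubChoice_isSubPOrder of fix_lattice by <: with set_display].

Implicit Types U V W : fix_lattice.

Definition mk_fix A (FA : frame_fixpoint A) : fix_lattice :=
  FixLattice (mem_set FA).

Lemma fix_latticeP U : frame_fixpoint U.
Proof. exact: set_mem (fix_setP U). Qed.

Lemma fix_leP U V : (U <= V) <-> ((U : set X) `<=` (V : set X)).
Proof. by rewrite -Order.le_val; split; [move/subsetPset | move=> ?; apply/subsetPset]. Qed.

Definition fix_meet U V : fix_lattice.
Proof.
apply: (@mk_fix (U `&` V)); apply: frame_fixpointP => x cx; split.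
- by apply: (frame_fixpoint_sub (fix_latticeP U)); apply: frame_closureS cx => y [].
- by apply: (frame_fixpoint_sub (fix_latticeP V)); apply: frame_closureS cx => y [].
Defined.

Definition fix_join U V : fix_lattice :=
  mk_fix (frame_closure_fixpoint (U `|` V)).

Definition fix_bot : fix_lattice := mk_fix (frame_closure_fixpoint set0).

Definition fix_top : fix_lattice :=
  mk_fix (frame_fixpointP (@subsetT _ (frame_closure setT))).

Definition fix_bigmeet (S : set fix_lattice) : fix_lattice :=
  mk_fix (frame_bigcap_fixpoint S fix_latticeP).

Definition fix_bigjoin (S : set fix_lattice) : fix_lattice :=
  mk_fix (frame_closure_fixpoint (\bigcup_(V in S) (V : set X))).

Fact fix_lexI W U V : (W <= fix_meet U V) = (W <= U) && (W <= V).
Proof.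
apply/idP/andP => [/fix_leP s|[/fix_leP sU /fix_leP sV]].
  by split; apply/fix_leP => x /s[].
by apply/fix_leP => x Wx; split; [apply: sU | apply: sV].
Qed.

Fact fix_leUx U V W : (fix_join U V <= W) = (U <= W) && (V <= W).
Proof.
apply/idP/andP => [/fix_leP s|[/fix_leP sU /fix_leP sV]].
  by split; apply/fix_leP => x ?; apply: s; apply: frame_closure_sub;
    [left | right].
apply/fix_leP => x cx; apply: (frame_fixpoint_sub (fix_latticeP W)).
by apply: frame_closureS cx => y [/sU|/sV].
Qed.

Fact fix_le0x U : fix_bot <= U.
Proof.
apply/fix_leP => x cx; apply: (frame_fixpoint_sub (fix_latticeP U)).
exact: frame_closureS cx.
Qed.

Fact fix_lex1 U : U <= fix_top.
Proof. exact/fix_leP. Qed.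

HB.instance Definition _ :=
  Order.POrder_isMeetSemilattice.Build set_display fix_lattice fix_lexI.
HB.instance Definition _ :=
  Order.POrder_isJoinSemilattice.Build set_display fix_lattice fix_leUx.
HB.instance Definition _ :=
  Order.hasBottom.Build set_display fix_lattice fix_le0x.
HB.instance Definition _ :=
  Order.hasTop.Build set_display fix_lattice fix_lex1.

Definition fix_imp U V : fix_lattice := mk_fix (frame_imp_fixpoint U V).

Lemma fix_infimumP (S : set fix_lattice) U :
  infimums S U <-> (U : set X) = \bigcap_(V in S) (V : set X).
Proof.
split=> [[lb glb]|eqU].
  apply/seteqP; split=> [x Ux V SV|]; first exact: (proj1 (fix_leP _ _) (lb V SV)).
  have : fix_bigmeet S <= U.
    by apply: glb => V SV; apply/fix_leP => x; apply.
  by move/fix_leP.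
split=> [V SV|W lbW]; apply/fix_leP; rewrite eqU; first by move=> x; apply.
by move=> x Wx V SV; apply: (proj1 (fix_leP _ _) (lbW V SV)).
Qed.

Lemma fix_supremumP (S : set fix_lattice) U :
  supremums S U <-> (U : set X) = frame_closure (\bigcup_(V in S) (V : set X)).
Proof.
split=> [[ub lub]|eqU].
  apply/seteqP; split; last first.
    move=> x cx; apply: (frame_fixpoint_sub (fix_latticeP U)).
    apply: frame_closureS cx => y [V SV Vy].
    exact: (proj1 (fix_leP _ _) (ub V SV)).
  have : U <= fix_bigjoin S.
    apply: lub => V SV; apply/fix_leP => x Vx.
    by apply: frame_closure_sub; exists V.
  by move/fix_leP.
split=> [V SV|W ubW]; apply/fix_leP; rewrite eqU.
  by move=> x Vx; apply: frame_closure_sub; exists V.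
move=> x cx; apply: (frame_fixpoint_sub (fix_latticeP W)).
apply: frame_closureS cx => y [V SV Vy].
exact: (proj1 (fix_leP _ _) (ubW V SV)).
Qed.

End RelationalFrame.

Lemma fix_lattice_complete (X : Type) (R : X -> X -> Prop) :
  is_complete_lattice (fix_lattice R).
Proof.
move=> S; split; [exists (fix_bigmeet S) | exists (fix_bigjoin S)].
  exact/fix_infimumP.
exact/fix_supremumP.
Qed.

Section PreconditionalFrame.
Variables (d : Order.disp_t) (L : tbLatticeType d) (imp : L -> L -> L).

Definition pcond_points : set (L * L) :=
  [set p | exists x y, p = (x, imp x y)].

Definition pcond_rel (p q : pcond_points) : Prop :=
  ~~ ((val q).1 <= (val p).2).

Lemma pcond_points_nonempty : pcond_points !=set0.
Proof. by exists (\top, imp \top \top); exists \top, \top. Qed.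

End PreconditionalFrame.

Arguments pcond_rel {d L} imp p q.
Arguments fix_imp {X} R U V.

(* Main.v *)
(** The embedding sends [a] to the set of points [(x, x -> y)] with [x <= a].
    This set is a fixpoint because [1 -> a = a], so that [(1, a)] is a point,
    which separates [a] from every [x] not below it. Each point of [P] serves
    twice: its first coordinate is tested for membership, its second one
    separates. As [(x, x -> y)] is a point for all [x] and [y], the first
    coordinates exhaust [L], and the second ones determine [->]. *)
Require Import Defs.
From mathcomp Require Import all_boot all_order.
From mathcomp Require Import boolp classical_sets.

Set Implicit Arguments.
Unset Strict Implicit.
Unset Printing Implicit Defensive.

Import Order.TTheory.
Local Open Scope order_scope.
Local Open Scope classical_set_scope.

Section Preconditional.
Variables (d : Order.disp_t) (L : tbLatticeType d) (imp : L -> L -> L).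
Hypothesis himp : preconditional imp.

Lemma pcond_top_eq a : imp \top a = a.
Proof.
apply/le_anti/andP; split; first exact: pcond_top.
by have := pcond_meet_le himp \top a; rewrite meet1x.
Qed.

(** Replacing [b] by its meet with [a] and then using monotonicity gives
    [imp a b <= imp a (imp u v)]; since [u <= a], weakening drops the outer [a]. *)
Lemma pcond_le_trans a b u v : u <= a -> (a `&` b)%O <= imp u v ->
  imp a b <= imp u v.
Proof.
move=> ua abuv; apply: le_trans (pcond_le_meet himp a b) _.
apply: le_trans (pcond_mono himp a abuv) _.
exact: pcond_weaken.
Qed.

End Preconditional.

Section Embedding.
Variables (d : Order.disp_t) (L : tbLatticeType d) (imp : L -> L -> L).
Hypothesis himp : preconditional imp.

Local Notation P := (pcond_points imp).
Local Notation R := (pcond_rel imp).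

Definition pcond_point (x y : L) : P :=
  SigSub (mem_set (ex_intro _ x (ex_intro _ y erefl)) : (x, imp x y) \in P).

Lemma pcond_pointP (p : P) : exists x y, p = pcond_point x y.
Proof.
by have [x [y pE]] := set_valP p; exists x, y; apply: val_inj.
Qed.

Definition pcond_down (a : L) : set P := [set p | (val p).1 <= a].

Lemma pcond_down_fixpoint a : frame_fixpoint R (pcond_down a).
Proof.
apply: frame_fixpointP => p cp; rewrite /pcond_down /=; apply: contrapT => pa.
have rp : R (pcond_point \top a) p.
  by rewrite /pcond_rel /= pcond_top_eq //; apply/negP.
have [q [/negP rq qa]] := cp _ rp.
by apply: rq; rewrite /= pcond_top_eq.
Qed.

Definition pcond_embed (a : L) : fix_lattice R :=
  mk_fix (pcond_down_fixpoint a).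

Lemma pcond_embed_le : {mono pcond_embed : a b / a <= b}.
Proof.
move=> a b; apply/idP/idP => [/fix_leP/(_ (pcond_point a a)) ab|ab].
  by apply: ab; rewrite /= /pcond_down /=.
by apply/fix_leP => p /= pa; apply: le_trans pa ab.
Qed.

Lemma pcond_embed_inj : injective pcond_embed.
Proof.
by move=> a b ab; apply/le_anti; rewrite -!pcond_embed_le ab lexx.
Qed.

Lemma pcond_embed_meet (S : set L) m :
  infimums S m -> infimums (pcond_embed @` S) (pcond_embed m).
Proof.
move=> [lb glb]; apply/fix_infimumP/seteqP; split=> [p pm _ [s Ss <-]|p pS] /=.
  by apply: le_trans pm _; apply: lb.
by apply: glb => s Ss; apply: (pS (pcond_embed s)); exists s.
Qed.

Lemma le_supremumsPn (S : set L) m b :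
  supremums S m -> ~~ (m <= b) -> exists2 s, S s & ~~ (s <= b).
Proof.
move=> [_ lub] mb; apply: contrapT => noS; move/negP: mb; apply.
by apply: lub => s Ss; apply: contrapT => /negP sb; apply: noS; exists s.
Qed.

(* The first coordinates of any set [A] of points determine its closure, since
   [p <| q] depends on [q] through its first coordinate only. *)
Lemma frame_closure_pcond (A : set P) m :
  supremums [set (val p).1 | p in A] m -> frame_closure R A = pcond_down m.
Proof.
move=> supm; apply/seteqP; split=> p.
  move=> cp; apply: (frame_fixpoint_sub (pcond_down_fixpoint m)).
  by apply: frame_closureS cp => q Aq; apply: (proj1 supm); exists q.
move=> pm q rqp; have mq : ~~ (m <= (val q).2).
  by apply: contra rqp; apply: le_trans.
by have [_ [r Ar <-] rq] := le_supremumsPn supm mq; exists r.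
Qed.

Lemma pcond_embed_join (S : set L) m :
  supremums S m -> supremums (pcond_embed @` S) (pcond_embed m).
Proof.
move=> [ub lub]; apply/fix_supremumP; symmetry; apply: frame_closure_pcond.
split=> [_ [p [_ [s Ss <-] ps] <-]|b ubb]; first exact: le_trans ps (ub _ Ss).
apply: lub => s Ss; apply: ubb; exists (pcond_point s s) => //.
(* Each [s] in [S] is itself a first coordinate in the union, so the union of the down-sets has the
   same upper bounds as [S]. *)
by exists (pcond_embed s); [exists s|rewrite /= /pcond_down /=].
Qed.

Lemma pcond_embed_imp :
  {morph pcond_embed : a b / imp a b >-> fix_imp R a b}.
Proof.
move=> a b; apply: val_inj; apply/seteqP; split=> p; rewrite /= /pcond_down /=.
  move=> pab q rqp qa; apply: contrapT => noz.
  have [u [v qE]] := pcond_pointP q; move: rqp qa noz; rewrite {}qE /=.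
  move=> /negP rqp ua noz; apply: rqp; apply: le_trans pab _.
  apply: pcond_le_trans => //; apply: contrapT => /negP abuv; apply: noz.
  (* The relation looks only at the first coordinate of this witness, so [\top] is an arbitrary
     choice. *)
  exists (pcond_point (a `&` b)%O \top); split=> //.
  by split; [apply: leIl|apply: leIr].
move=> pab; apply: contrapT => /negP npab.
(* The point [(a, imp a b)] is the test: the resulting [z] has its first coordinate below [a] and
   [b], hence below [imp a b], which the relation forbids. *)
have [z [/negP rz [za zb]]] := pab (pcond_point a b) npab (lexx a).
by apply: rz; apply: le_trans (pcond_meet_le himp a b); rewrite lexI za.
Qed.

(** A fixpoint is its own closure, hence the image of the supremum of its first coordinates; taking
    that supremum is the inverse map. *)
Lemma pcond_embed_bij : is_complete_lattice L -> bijective pcond_embed.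
Proof.
move=> cL; pose dom (U : fix_lattice R) := [set (val p).1 | p in (U : set P)].
have /choice[g supg] (U : fix_lattice R) : exists m, supremums (dom U) m.
  by have [_ []] := cL (dom U) => m; exists m.
have gK : cancel g pcond_embed.
  by move=> U; apply: val_inj; rewrite -[RHS](fix_latticeP U)
    (frame_closure_pcond (supg U)).
by exists g => // a; apply: pcond_embed_inj; rewrite gK.
Qed.

End Embedding.

Theorem theorem6p3 (d : Order.disp_t) (L : tbLatticeType d)
    (imp : L -> L -> L) (himp : preconditional imp) :
  exists f : L -> fix_lattice (pcond_rel imp),
    complete_embedding imp (fix_imp (pcond_rel imp)) f /\
    (is_complete_lattice L ->
       lattice_isomorphism imp (fix_imp (pcond_rel imp)) f).
Proof.
exists (pcond_embed himp); split=> [|cL]; split.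
- exact: pcond_embed_inj.
- exact: pcond_embed_meet.
- exact: pcond_embed_join.
- exact: pcond_embed_imp.
- exact: pcond_embed_bij.
- exact: pcond_embed_le.
- exact: pcond_embed_imp.
Qed.
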